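(* $(\alpha)$ Let $g\ge 2$ be an integer which is a power of $2$. Then $4^gV_g\ge 3g$. $(\beta)$ Let $g$ be an integer of the form $g=\varphi(n)$ for some integer $n\ge 3$, where $\varphi$ is Euler's totient function. Then $4^gV_g\ge 2g+2$.
   Context: Let $(A;L)$ be a principally polarized complex abelian variety of dimension $g\ge 1$. Put $T_A=\Gamma(A;\Omega_{A/\mathbb{C}})^\vee$ (the dual of the space of global holomorphic 1-forms, i.e. the tangent space at the origin), and let $\Gamma_A\subset T_A$ be the period lattice of $A$, so that $A(\mathbb{C})\simeq T_A/\Gamma_A$ as complex analytic groups. The polarization $L$ induces a Riemann form $\langle\ ;\ \rangle$ on $T_A$, i.e. a (positive definite) Hermitian inner product on $T_A$ such that $\mathrm{Im}\langle\gamma_1;\gamma_2\rangle\in\mathbb{Z}$ for all $(\gamma_1;\gamma_2)\in\Gamma_A^2$. For a lattice $\Gamma$ of an $n$-dimensional Euclidean space, $\lambda_1(\Gamma)=\min_{\gamma\in\Gamma\setminus\{0\}}\|\gamma\|$ is its first minimum, and its packing density $\Delta(\Gamma)$ is the density of the packing by balls of radius $\lambda_1(\Gamma)/2$ centred at the points of $\Gamma$. If $\Gamma$ has covolume 1, then $\Delta(\Gamma)=\frac{v_n}{2^n}\lambda_1(\Gamma)^n$, where $v_n$ is the volume of the unit ball of $\mathbb{R}^n$. The injectivity volume $V(A;L)$ is the packing density of the lattice $\Gamma_A$ in the Euclidean space $(T_A;\mathrm{Re}\langle\ ;\ \rangle)$, of real dimension $2g$. Equivalently, it is the largest volume of an open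 ball of $T_A$ that injects into $A$, with volume normalized so that $\Gamma_A$ has covolume 1. For an integer $g\ge1$, $V_g=\sup V(A;L)$, the supremum being over all principally polarized complex abelian varieties $(A;L)$ of dimension $g$. *)

(* Defs.v *)
From HB Require Import structures.
From mathcomp Require Import all_boot all_order all_algebra.
From mathcomp Require Import sesquilinear complex.
From mathcomp Require Import all_classical all_reals all_analysis.

Set Implicit Arguments.
Unset Strict Implicit.
Unset Printing Implicit Defensive.

Import Order.TTheory GRing.Theory Num.Theory VectorInternalTheory.
Local Open Scope classical_set_scope.
Local Open Scope ring_scope.

(* Lebesgue measure on R^n by iterated integration (Tonelli); meaningful on
   measurable sets only. *)
Fixpoint lebesgue_tuple (R : realType) (n : nat) : set (n.-tuple R) -> \bar R :=
  match n with
  | 0 => fun A => \d_([tuple] : 0.-tuple R) A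
  | n'.+1 => fun A =>
      (\int[@lebesgue_measure R]_x
         lebesgue_tuple [set t : n'.-tuple R | A [tuple of x :: t]])%E
  end.

Definition unit_ball_volume (R : realType) (n : nat) : \bar R :=
  lebesgue_tuple [set x : n.-tuple R | \sum_(i < n) tnth x i ^+ 2 < 1].

Section Lattices.
Variables (R : realType) (V : vectType R).
Implicit Types (b : (\dim {:V}).-tuple V) (L : set V).

Definition lattice_basis b L :=
  basis_of {:V} b /\
  L = [set \sum_(i < \dim {:V}) tnth b i *~ m i | m in [set: 'I_(\dim {:V}) -> int]].

Definition is_lattice L := exists b, lattice_basis b L.

Variable ip : {dot V for (@idfun R)}.

Definition first_minimum L : R :=
  inf [set Num.sqrt (ip v v) | v in L `\ 0].

(* Square root of a Gram determinant, which does not depend on the basis of L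
   that xget selects. *)
Definition covolume L : R :=
  let b := xget (vbasis {:V}) [set b | lattice_basis b L] in
  Num.sqrt (\det (\matrix_(i, j) ip (tnth b i) (tnth b j))).

(* Density of the packing by balls of radius first_minimum L / 2 centred at L:
   the balls have disjoint interiors and there is one per fundamental domain,
   so the proportion of space they fill is vol (ball) / covolume L. *)
Definition packing_density L : \bar R :=
  (unit_ball_volume R (\dim {:V})
   * ((first_minimum L / 2) ^+ \dim {:V} / covolume L)%:E)%E.

End Lattices.

(* T regarded as a real vector space. *)
Definition realification (R : realType) (T : vectType R[i]) : Type := T.

Section Realification.
Variables (R : realType) (T : vectType R[i]).
Local Notation TR := (realification T).

HB.instance Definition _ := GRing.Zmodule.on TR.

Definition real_scale (r : R) (v : TR) : TR := (r%:C)%C *: (v : T).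

Fact real_scaleA a b v : real_scale a (real_scale b v) = real_scale (a * b) v.
Proof. by rewrite /real_scale scalerA -rmorphM. Qed.
Fact real_scale1 : left_id 1 real_scale.
Proof. by move=> v; rewrite /real_scale rmorph1 scale1r. Qed.
Fact real_scaleDr : right_distributive real_scale +%R.
Proof. by move=> a u v; rewrite /real_scale scalerDr. Qed.
Fact real_scaleDl v : {morph real_scale^~ v : a b / a + b}.
Proof. by move=> a b; rewrite /real_scale rmorphD scalerDl. Qed.

HB.instance Definition _ := GRing.Zmodule_isLmodule.Build R TR
  real_scaleA real_scale1 real_scaleDr real_scaleDl.

Lemma real_scaleE (a : R) (v : TR) : a *: v = (a%:C)%C *: (v : T) :> T.
Proof. by []. Qed.

Definition real_coord (v : TR) : 'rV[R]_(dim T + dim T) :=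
  row_mx (map_mx (@complex.Re R) (v2r (v : T)))
         (map_mx (@complex.Im R) (v2r (v : T))).

Fact real_vect_axiom : Vector.axiom (dim T + dim T) TR.
Proof.
exists real_coord.
  move=> a u v; rewrite /real_coord.
  have -> : v2r (a *: u + v : T)
      = (a%:C)%C *: v2r (u : T) + v2r (v : T) by rewrite -linearP.
  rewrite scale_row_mx add_row_mx; congr row_mx; apply/rowP=> i; rewrite !mxE.
    by case: (v2r (u : T) 0 i) (v2r (v : T) 0 i) => [x y] [z t] /=;
       rewrite mul0r subr0.
  by case: (v2r (u : T) 0 i) (v2r (v : T) 0 i) => [x y] [z t] /=;
     rewrite mul0r addr0.
exists (fun w => r2v (\row_i Complex (lsubmx w 0 i) (rsubmx w 0 i)) : TR).
  move=> v; rewrite /real_coord row_mxKl row_mxKr; apply: (@v2r_inj R[i] T).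
  rewrite r2vK; apply/rowP => i; rewrite !mxE.
  by case: (v2r (v : T) 0 i).
move=> w; rewrite /real_coord r2vK -[RHS]hsubmxK.
by congr row_mx; apply/rowP => i; rewrite !mxE.
Qed.

HB.instance Definition _ := Lmodule_hasFinDim.Build R TR real_vect_axiom.


(* {dot T for conj}: positive definite Hermitian, linear on the left. The form
   Re <u ; v> is then an inner product on the underlying real space. *)
Variable H : {dot T for @Num.conj R[i]}.

Definition re_form (u v : TR) : R := complex.Re (H (u : T) (v : T)).

Fact re_form_addl v : zmod_morphism (re_form ^~ v).
Proof. by move=> x y; rewrite /re_form linearBl raddfB. Qed.
Fact re_form_addr u : zmod_morphism (re_form u).
Proof. by move=> x y; rewrite /re_form linearBr raddfB. Qed.
Fact re_form_scalel v : scalable_for *%R (re_form ^~ v).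
Proof.
move=> a x; rewrite /re_form real_scaleE linearZl_LR /=.
by case: (H _ _) => y z /=; rewrite mul0r subr0.
Qed.
Fact re_form_scaler u : scalable_for (@idfun R \; *%R) (re_form u).
Proof.
move=> a x; rewrite /re_form real_scaleE linearZr_LR /=.
by case: (H _ _) => y z /=; rewrite oppr0 mul0r subr0.
Qed.
Fact re_form_sym u v : re_form u v = (-1) ^+ false * re_form v u.
Proof.
have Re_conj (z : R[i]) : complex.Re (Num.conj z) = complex.Re z by case: z.
rewrite expr0 mul1r /re_form [H _ _](@hermitian_subproof _ _ _ _ H).
by rewrite expr0 mul1r Re_conj.
Qed.
Fact re_form_gt0 u : u != 0 -> 0 < re_form u u.
Proof.
by move=> /(@neq0_dnorm_gt0 _ _ _ H); rewrite ltcE => /andP[].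
Qed.

HB.instance Definition _ := isBilinear.Build R TR TR R *%R (@idfun R \; *%R)
  re_form re_form_addl re_form_addr re_form_scalel re_form_scaler.
HB.instance Definition _ :=
  isHermitianSesquilinear.Build R TR false (@idfun R) re_form re_form_sym.
HB.instance Definition _ := isDotProduct.Build R TR re_form re_form_gt0.

End Realification.

(* A principally polarized complex abelian variety of dimension g, through its
   analytic uniformization (T / periods, H): by the theorems of Riemann,
   Appell-Humbert and Lefschetz the algebraic objects correspond to complex tori
   endowed with a positive definite Hermitian form H on T whose imaginary part E
   is integral on the periods. The kernel of phi_L : A -> A^dual is
   {u | E(u, periods) in Z} / periods, so riemann_principal says that phi_L is
   an isomorphism. *)
Record ppav (R : realType) (g : nat) := PPAV {
  tangent : vectType R[i];
  tangent_dim : \dim {:tangent} = g;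
  periods : set (realification tangent);
  periods_lattice : is_lattice periods;
  riemann_form : {dot tangent for @Num.conj R[i]};
  riemann_int : forall u v, periods u -> periods v ->
    complex.Im (riemann_form u v) \is a Num.int;
  riemann_principal : forall u,
    (forall v, periods v -> complex.Im (riemann_form u v) \is a Num.int) ->
    periods u
}.

Arguments periods {R g} p _ : rename.
Arguments riemann_form {R g} p : rename.

Definition injectivity_volume (R : realType) (g : nat) (A : ppav R g) : \bar R :=
  packing_density (@re_form R (tangent A) (riemann_form A)) (periods A).

(* V_g; the supremum is taken in the extended reals, hence needs no
   boundedness convention. *)
Definition sup_injectivity_volume (R : realType) (g : nat) : \bar R :=
  ereal_sup [set d | exists A : ppav R g, d = injectivity_volume A].

(* Main.v *)
Require Import Defs.
From HB Require Import structures.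
From mathcomp Require Import all_boot all_order all_algebra all_field.
From mathcomp Require Import sesquilinear spectral complex.
From mathcomp Require Import all_classical all_reals all_analysis.
From mathcomp Require Import measurable_realfun ring lra zify.

(** Let [n >= 1], [g = phi(n)] and let [h] be large. For a functional [l] on
    [Z[zeta_n]], let [X_l] be the symmetric form [(a, b) |-> l (a b)]. The lattices
      [{h (m + X_l v / q) + i h^-1 v}],  [v] in [Z[zeta_n]], [m] in its dual,
    written in orthonormal coordinates for a [zeta_n]-invariant inner product,
    are symplectic, hence period lattices of principally polarized abelian
    varieties, and [zeta_n] acts on each of them by isometries, freely on the
    nonzero vectors (although not symplectically). When [l] runs over the
    functionals modulo a large prime [q], a pair [(q m + X_l v, v)] with
    [v <> 0] arises for at most one [l], because multiplication by [v] is
    invertible modulo [q]. If every one of these lattices had a nonzero vector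
    shorter than [r], the orbits of these vectors would yield [n q^g] distinct
    points of a grid of covolume [q^-g] in the ball of radius [r], so that
    [n <= vol (B(r + o(1)))]. Hence [4^g V_g >= n].
    Both statements follow by choosing [n]: a power [g = 2^k >= 2] is
    [phi(3 g)], while [lcm(2, n) >= 2 phi(n) + 2] if [n] is not a power of [2]. *)

Set Implicit Arguments.
Unset Strict Implicit.
Unset Printing Implicit Defensive.
Import Order.TTheory GRing.Theory Num.Theory.
Local Open Scope ring_scope.

(** * Cyclotomic integers as matrices *)

(** ['Phi_n] is the minimal polynomial of [z] over the rationals. Write it as [e] times its gcd with
    [q]: the gcd divides [q], so it cannot vanish at [z]; hence [e] does, takes the whole degree,
    and the gcd is constant. *)
Lemma coprimep_Cyclotomic n (z : algC) (q : {poly rat}) :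
  n.-primitive_root z -> ~~ root (map_poly ratr q) z ->
  coprimep q (map_poly intr 'Phi_n).
Proof.
move=> prim_z qz0; set f : {poly rat} := map_poly intr _.
have [pf [Dpf mon_pf] dv_pf] := minCpolyP z.
have Df : f = pf.
  apply: (map_inj_poly (fmorph_inj (ratr : rat -> algC))); first exact: rmorph0.
  rewrite -Dpf (minCpoly_cyclotomic prim_z) -(Cintr_Cyclotomic prim_z).
  by rewrite -map_poly_comp; apply: eq_map_poly => b; rewrite /= rmorph_int.
rewrite Df; have pf0 : pf != 0 := monic_neq0 mon_pf.
have /dvdpP[e De] := dvdp_gcdr q pf.
have e0 : e != 0 by apply: contraNneq pf0 => e0; rewrite De e0 mul0r.
have d0 : gcdp q pf != 0 by apply: contraNneq pf0 => d0; rewrite De d0 mulr0.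
have : root (map_poly ratr pf) z by rewrite dv_pf.
rewrite {1}De rmorphM rootM /= => /orP[|]; last first.
  rewrite dv_pf => /dvdp_trans/(_ (dvdp_gcdl _ _)).
  by rewrite -dv_pf (negPf qz0).
rewrite dv_pf => /(dvdp_leq e0); rewrite {1}De size_mul// /coprimep.
have := size_poly_gt0 (gcdp q pf); have := size_poly_gt0 e.
rewrite d0 e0; case: (size _) => [//|m]; case: (size _) => [//|[//|k]] _ _.
by rewrite !addSn !addnS /= ltnNge -addSn leq_addr.
Qed.

(** [B] is the companion matrix of ['Phi_n], that is, multiplication by zeta_n in the power basis,
    and [e0] stands for 1. The determinants are norms of nonzero elements of the cyclotomic
    field. *)
Lemma cyclotomic_matrix n g : (0 < n)%N -> g.+1 = totient n ->
  exists (B : 'M[int]_g.+1) (e0 : 'rV[int]_g.+1),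
  [/\ forall i : 'I_g.+1, e0 *m B ^+ i = delta_mx 0 i,
      B ^+ n = 1,
      forall v : 'rV_g.+1, v != 0 -> \det (\sum_i v 0 i *: B ^+ i) != 0
    & forall k, (0 < k < n)%N -> \det (B ^+ k - 1) != 0].
Proof.
move=> n_gt0 gn; pose f := 'Phi_n.
have szf : size f = g.+2 by rewrite size_Cyclotomic gn.
pose B := \matrix_(i < g.+1, j < g.+1)
  if i == g :> nat then - f`_j else (i.+1 == j :> nat)%:R.
have char_B : char_poly B = f.
  (* [companionmxK] indexes its matrix by the size of the polynomial, so the dimension is
     generalized first. *)
  suff H m : m = (size f).-1 -> char_poly (\matrix_(i < m, j < m)
    if i == m.-1 :> nat then - f`_j else (i.+1 == j :> nat)%:R) = f.
    by apply: H; rewrite szf.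
  by move=> ->; apply: companionmxK; exact: Cyclotomic_monic.
have fB : horner_mx B f = 0 by rewrite -char_B Cayley_Hamilton.
have [z prim_z] := C_prim_root_exists n_gt0.
have detB (q : {poly int}) :
    ~~ root (map_poly ratr (map_poly intr q : {poly rat})) z ->
    \det (horner_mx B q) != 0.
  (* A Bezout relation between [q] and ['Phi_n], evaluated at [B], loses its second term since
     ['Phi_n] kills [B]; so q(B) is invertible over the rationals. *)
  move=> /(coprimep_Cyclotomic prim_z)/Bezout_eq1_coprimepP[[u v]] /= uv.
  have := congr1 (horner_mx (map_mx intr B : 'M[rat]_g.+1)) uv.
  rewrite rmorphD !rmorphM rmorph1 /= -!map_horner_mx fB map_mx0 mulr0 addr0.
  move=> /(congr1 determinant); rewrite det_mulmx det1 det_map_mx => /eqP.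
  by apply: contraTneq => ->; rewrite mulr0 eq_sym oner_eq0.
exists B, (delta_mx 0 0); split.
- case; elim=> [|i IHi] hi.
    by rewrite expr0 mulmx1; congr delta_mx; apply: val_inj.
  rewrite exprSr mulmxA IHi; first exact: ltnW.
  move=> hi'; rewrite -rowE; apply/rowP => j; rewrite !mxE eqxx /= ltn_eqF//.
  by congr _%:R; rewrite -val_eqE /= eq_sym.
- have : horner_mx B ('X^n - 1) = 0.
    rewrite -prod_Cyclotomic// (big_rem n) -?dvdn_divisors//= rmorphM /= fB.
    by rewrite mul0r.
  rewrite rmorphB rmorph1 rmorphXn /= horner_mx_X => /eqP.
  by rewrite subr_eq0 => /eqP.
- move=> v v0.
  have -> : \sum_i v 0 i *: B ^+ i = horner_mx B (rVpoly v).
    rewrite /rVpoly poly_def linear_sum /=; apply: eq_bigr => i _.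
    rewrite insubT//= => ?; rewrite linearZ /= rmorphXn /= horner_mx_X.
    by congr (v _ _ *: _); apply: val_inj.
  apply: detB.
  have [pf [Dpf mon_pf] dv_pf] := minCpolyP z; rewrite dv_pf.
  apply: contra v0 => pfv.
  (* The minimal polynomial has degree g + 1, whereas [rVpoly v] has degree at most g. *)
  have sz_pf : size pf = g.+2.
    have := congr1 (size \o val) Dpf; rewrite /= size_map_poly => <-.
    by rewrite (minCpoly_cyclotomic prim_z) size_cyclotomic gn.
  apply/eqP; rewrite -[v]rVpolyK; suff -> : rVpoly v = 0 by rewrite linear0.
  apply: (map_inj_poly (intr_inj : injective (intr : int -> rat))) => //.
  rewrite rmorph0; apply/eqP; apply: contraTT pfv => nz.
  apply: contra nz => /dvdp_leq nz; apply/negPn/negP => /nz.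
  rewrite sz_pf size_map_inj_poly//; last exact: intr_inj.
  by rewrite leqNgt ltnS size_poly.
- move=> k /andP[k0 kn].
  have -> : B ^+ k - 1 = horner_mx B ('X^k - 1).
    by rewrite rmorphB rmorph1 rmorphXn /= horner_mx_X.
  apply: detB; rewrite !rmorphB !rmorph1 /= !map_polyXn rootE !hornerE.
  rewrite subr_eq0 -(prim_order_dvd prim_z).
  by rewrite gtnNdvd.
Qed.

(** * Invariant quadratic forms *)

(** Induction through the Schur complement of the top left entry. The inverse [Q] is built alongside
    because the dual lattice needs its triangular shape and positive diagonal. *)
Lemma cholesky (R : rcfType) n (Y : 'M[R]_n) : Y^T = Y ->
  (forall v : 'rV_n, v != 0 -> 0 < (v *m Y *m v^T) 0 0) ->
  exists P Q : 'M[R]_n, [/\ is_trig_mx P, is_trig_mx Q,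
    forall i, 0 < P i i, forall i, 0 < Q i i & P *m Q = 1%:M /\ P *m P^T = Y].
Proof.
elim: n Y => [|n IHn] Y symY posY.
  exists 0, 0; split; first by apply/is_trig_mxP => -[].
  - by apply/is_trig_mxP => -[].
  - by case.
  - by case.
  - by split; apply/matrixP => -[].
move: Y symY posY; rewrite -[n.+1]/(1 + n)%N => Y.
rewrite -[Y]submxK; move: (ulsubmx Y) (ursubmx Y) (dlsubmx Y) (drsubmx Y).
move=> a bT b Z {Y}; rewrite tr_block_mx => /eq_block_mx[_ <- _ ZE].
set al := a 0 0.
have aE : a = al%:M by rewrite [LHS]mx11_scalar.
move=> pos.
have al_gt0 : 0 < al.
  have /pos : row_mx 1%:M 0 != 0 :> 'rV[R]_(1 + n).
    rewrite -(row_mx0 _ 1 1 n); apply/eqP => /eq_row_mx[/matrixP/(_ 0 0)/eqP].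
    by rewrite !mxE oner_eq0.
  by rewrite mul_row_block tr_row_mx mul_row_col trmx0 trmx1 mulmx0 addr0
    mulmx1 mul1mx mul0mx addr0.
have [P [Q [trP trQ dP dQ [PQ PP]]]] : exists P Q : 'M[R]_n,
    [/\ is_trig_mx P, is_trig_mx Q, forall i, 0 < P i i, forall i, 0 < Q i i
      & P *m Q = 1%:M /\ P *m P^T = Z - al^-1 *: (b *m b^T)].
  apply: IHn => [|v v0].
    by rewrite linearB linearZ /= trmx_mul trmxK ZE.
  (* This vector completes the square: the full form takes on it the value of the Schur complement
     at [v]. *)
  have /pos : row_mx (- al^-1 *: (v *m b)) v != 0 :> 'rV[R]_(1 + n).
    apply: contraNneq v0; rewrite -(row_mx0 _ 1 1 n) => /eq_row_mx[_ ->].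
    exact: eqxx.
  rewrite mul_row_block tr_row_mx mul_row_col aE -!scalemxAl.
  rewrite mul_mx_scalar.
  rewrite scalerA mulNr mulVf ?gt_eqF// scaleN1r addNr mul0mx add0r.
  by rewrite mulmxBr -scalemxAr -scaleNr !mulmxDl -!scalemxAl !mulmxA addrC.
pose s := Num.sqrt al.
have s_gt0 : 0 < s by rewrite sqrtr_gt0.
have ss : s * s = al by rewrite -expr2 sqr_sqrtr// ltW.
have s0 : s != 0 by rewrite gt_eqF.
exists (block_mx s%:M 0 (s^-1 *: b) P : 'M[R]_(1 + n)),
  (block_mx (s^-1)%:M 0 (- al^-1 *: (Q *m b)) Q : 'M[R]_(1 + n)).
have QP := mulmx1C PQ.
split.
- by rewrite is_trig_block_mx// trP scalar_mx_is_trig eqxx.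
- by rewrite is_trig_block_mx// trQ scalar_mx_is_trig eqxx.
- move=> i; case: (split_ordP i) => j ->.
    by rewrite block_mxEul ord1 mxE eqxx.
  by rewrite block_mxEdr.
- move=> i; case: (split_ordP i) => j ->.
    by rewrite block_mxEul ord1 mxE eqxx invr_gt0.
  by rewrite block_mxEdr.
split.
  rewrite mulmx_block !mul0mx !mulmx0 !addr0 !add0r PQ -scalar_mxM mulfV//.
  rewrite -scalemxAr mulmxA PQ mul1mx mul_mx_scalar scalerA -invfM ss.
  by rewrite scaleNr subrr scalar_mx_block.
rewrite tr_block_mx mulmx_block !trmx0 !mulmx0 !mul0mx !addr0 PP tr_scalar_mx.
rewrite -scalar_mxM ss -aE linearZ /= mul_scalar_mx scalerA mulfV// scale1r.
rewrite mul_mx_scalar scalerA mulfV// scale1r -scalemxAl -scalemxAr scalerA.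
by rewrite -invfM ss addrCA subrr addr0.
Qed.

(** * Euclidean norms and separation of boxes *)

Definition sqnorm (R : realDomainType) n (x : 'rV[R]_n) : R := (x *m x^T) 0 0.

Section SqNorm.
Variable R : realFieldType.

Lemma sqnormE n (x : 'rV[R]_n) : sqnorm x = \sum_k x 0 k ^+ 2.
Proof. by rewrite /sqnorm mxE; apply: eq_bigr => k _; rewrite mxE expr2. Qed.

Lemma sqnorm_ge0 n (x : 'rV[R]_n) : 0 <= sqnorm x.
Proof. by rewrite sqnormE sumr_ge0// => k _; exact: sqr_ge0. Qed.

Lemma sqnormZ n a (x : 'rV[R]_n) : sqnorm (a *: x) = a ^+ 2 * sqnorm x.
Proof. by rewrite /sqnorm linearZ /= -scalemxAl -scalemxAr scalerA mxE expr2. Qed.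

Lemma sqnorm_row_mx m n (x : 'rV[R]_m) (y : 'rV[R]_n) :
  sqnorm (row_mx x y) = sqnorm x + sqnorm y.
Proof. by rewrite /sqnorm tr_row_mx mul_row_col mxE. Qed.

Lemma sqr_le_sqnorm n (x : 'rV[R]_n) k : x 0 k ^+ 2 <= sqnorm x.
Proof.
rewrite sqnormE (bigD1 k)//= lerDl sumr_ge0// => j _; exact: sqr_ge0.
Qed.

(** Coordinatewise, the cross term is absorbed by the weighted arithmetic-geometric inequality. *)
Lemma sqnormD_le n (x y : 'rV[R]_n) t : 0 < t ->
  sqnorm (x + y) <= (1 + t) * sqnorm x + (1 + t^-1) * sqnorm y.
Proof.
move=> t_gt0; rewrite !sqnormE !mulr_sumr -big_split /=.
apply: ler_sum => k _; rewrite mxE; move: (x 0 k) (y 0 k) => a b.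
have : 0 <= t^-1 * (t * a - b) ^+ 2 by rewrite mulr_ge0 ?sqr_ge0 ?invr_ge0 ?ltW.
have -> : t^-1 * (t * a - b) ^+ 2 = t * a ^+ 2 - 2 * a * b + t^-1 * b ^+ 2.
  by field; rewrite gt_eqF.
lra.
Qed.

Lemma sqnorm_gt0 n (x : 'rV[R]_n) : x != 0 -> 0 < sqnorm x.
Proof.
by move=> /rV0Pn[k xk]; apply: lt_le_trans (sqr_le_sqnorm x k); rewrite exprn_even_gt0.
Qed.

(** For positive [d], this is disjointness of the half-open boxes of sides [d] based at two points
    with difference [x]. *)
Definition separates n (x d : 'rV[R]_n) :=
  exists k, d 0 k <= x 0 k \/ x 0 k <= - d 0 k.

Lemma separates_pivot n (P : 'M[R]_n) (u : 'rV[int]_n) k : 0 < P k k ->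
  u 0 k != 0 -> (map_mx intr u *m P) 0 k = (u 0 k)%:~R * P k k ->
  P k k <= (map_mx intr u *m P) 0 k \/ (map_mx intr u *m P) 0 k <= - P k k.
Proof.
move=> Pk uk ->; have : (1 <= u 0 k) || (u 0 k <= -1) by lia.
case/orP => h; [left|right].
  by rewrite ler_peMl ?ler1z ?(ltW Pk).
by rewrite -mulN1r ler_pM2r// -(mulrN1z (1 : R)) ler_int.
Qed.

(** At the last nonzero coordinate of [u] for the lower triangular [P], and at the first one for
    [P^T], the product reduces to a nonzero integer times a diagonal entry. So the box of sides
    [P k k] has disjoint translates under the lattice. *)
Lemma trig_separates n (P : 'M[R]_n) (u : 'rV[int]_n) : is_trig_mx P ->
  (forall k, 0 < P k k) -> u != 0 ->
  separates (map_mx intr u *m P) (\row_k P k k) /\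
  separates (map_mx intr u *m P^T) (\row_k P k k).
Proof.
move=> /is_trig_mxP trP dP /rV0Pn[k0 uk0].
split.
  case: (@arg_maxnP _ k0 (fun k => u 0 k != 0) val uk0) => k uk kmax.
  exists k; rewrite [(\row__ _) 0 k]mxE; apply: separates_pivot => //.
  rewrite mxE (bigD1 k)//= big1 ?addr0 ?mxE// => j jk; rewrite mxE.
  have [/trP ->|kj] := ltnP j k; first by rewrite mulr0.
  have /negPn/eqP -> : ~~ (u 0 j != 0); last by rewrite mul0r.
  by apply/negP => /kmax /=; rewrite leqNgt ltn_neqAle eq_sym (inj_eq val_inj) jk kj.
case: (@arg_minnP _ k0 (fun k => u 0 k != 0) val uk0) => k uk kmin.
exists k; rewrite [(\row__ _) 0 k]mxE.
have Pkk : P k k = P^T k k by rewrite mxE.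
rewrite Pkk; apply: separates_pivot => //; first by rewrite -Pkk.
rewrite mxE (bigD1 k)//= big1 ?addr0 ?mxE// => j jk; rewrite !mxE.
have [/trP ->|jk'] := ltnP k j; first by rewrite mulr0.
have /negPn/eqP -> : ~~ (u 0 j != 0); last by rewrite mul0r.
by apply/negP => /kmin /=; rewrite leqNgt ltn_neqAle (inj_eq val_inj) jk jk'.
Qed.

End SqNorm.

(** Averaging the standard form over the powers of [B] gives an invariant form [Y = P *m P^T]; its
    inverse [Q^T *m Q] is then invariant under [B^T]. *)
Lemma invariant_cholesky (R : rcfType) n g (B : 'M[int]_g) :
  (0 < n)%N -> B ^+ n = 1 ->
  exists P Q : 'M[R]_g, [/\ is_trig_mx P, is_trig_mx Q,
    forall i, 0 < P i i, forall i, 0 < Q i i &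
    [/\ P *m Q = 1%:M,
        forall x : 'rV[R]_g, sqnorm (x *m map_mx intr B *m P) = sqnorm (x *m P)
      & forall x : 'rV[R]_g,
          sqnorm (x *m map_mx intr B^T *m Q^T) = sqnorm (x *m Q^T)]].
Proof.
move=> n_gt0 Bn; pose C k : 'M[R]_g := map_mx intr (B ^+ k).
pose Y := \sum_(k < n) C k *m (C k)^T.
have CS k : map_mx intr B *m C k = C k.+1 by rewrite -map_mxM /C exprS.
have BYB : map_mx intr B *m Y *m (map_mx intr B)^T = Y.
  (* Conjugation shifts the index by one, and [B ^+ n = 1] turns the last term into the first. *)
  rewrite /Y mulmx_sumr mulmx_suml; case: n n_gt0 Bn @Y => // m _ Bn _.
  rewrite big_ord_recr big_ord_recl /= addrC; congr (_ + _).
    by rewrite mulmxA CS -mulmxA -trmx_mul CS /C Bn expr0.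
  by apply: eq_bigr => k _; rewrite mulmxA CS -mulmxA -trmx_mul CS.
have symY : Y^T = Y.
  by rewrite linear_sum /=; apply: eq_bigr => k _; rewrite trmx_mul trmxK.
have posY (v : 'rV_g) : v != 0 -> 0 < (v *m Y *m v^T) 0 0.
  move=> v0; rewrite mulmx_sumr mulmx_suml summxE (bigD1 (Ordinal n_gt0))//=.
  have E k : (v *m (C k *m (C k)^T) *m v^T) 0 0 = sqnorm (v *m C k).
    by rewrite /sqnorm trmx_mul !mulmxA.
  rewrite E /C expr0 map_mx1 mulmx1 ltr_wpDr ?sqnorm_gt0// sumr_ge0// => k _.
  by rewrite E sqnorm_ge0.
have [P [Q [trP trQ dP dQ [PQ PP]]]] := cholesky symY posY.
exists P, Q; split => //; split=> // x.
  rewrite /sqnorm !trmx_mul !mulmxA -(mulmxA _ P) PP -(mulmxA _ P) PP.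
  by rewrite -(mulmxA x) -(mulmxA x) BYB.
pose Z := Q^T *m Q.
have YZ : Y *m Z = 1%:M.
  rewrite -PP /Z mulmxA -(mulmxA P) -trmx_mul (mulmx1C PQ) trmx1 mulmx1.
  exact: PQ.
have ZE : Q^T *m Q = Z by []; clearbody Z.
have BZB : map_mx intr B^T *m Z *m map_mx intr B = Z.
  have /mulmx1C : map_mx intr B *m (Y *m map_mx intr B^T *m Z) = 1%:M.
    by rewrite !mulmxA -map_trmx BYB YZ.
  rewrite -2!mulmxA => YBZB; have := congr1 (mulmx Z) YBZB.
  by rewrite mulmx1 !mulmxA (mulmx1C YZ) mul1mx.
rewrite /sqnorm !trmx_mul !trmxK -!map_trmx !trmxK !mulmxA map_trmx.
rewrite -(mulmxA _ Q^T) ZE -[in RHS](mulmxA _ Q^T) ZE.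
by rewrite -(mulmxA x) -(mulmxA x) BZB.
Qed.

(** * The forms (a, b) -> l (a b) and their reduction modulo a prime *)

Section Hankel.
Variables (g : nat) (B : 'M[int]_g) (e0 : 'rV[int]_g).
Hypothesis e0B : forall i : 'I_g, e0 *m B ^+ i = delta_mx 0 i.

(* [B] is multiplication by a generator [z] of [Z[z]] in the basis [1, z, ...],
   and [hankel_mx l] is the matrix of the form [(a, b) |-> l (a b)]. *)
Definition hankel_mx (l : 'cV[int]_g) : 'M[int]_g := \matrix_(i, j) (B ^+ j *m l) i 0.
Definition mul_op (v : 'rV[int]_g) : 'M[int]_g := \sum_i v 0 i *: B ^+ i.

Lemma hankel_mxE l i j : hankel_mx l i j = (B ^+ j *m l) i 0.
Proof. by rewrite [LHS]mxE. Qed.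

(** Both sides are l (z^(i + k)); dependence on the sum of exponents alone yields the symmetry and
    commutation below. *)
Lemma power_col_hankel k (l : 'cV[int]_g) (i : 'I_g) :
  (B ^+ k *m l) i 0 = (e0 *m B ^+ (i + k) *m l) 0 0.
Proof. by rewrite exprD mulmxA e0B -mulmxA -rowE [RHS]mxE. Qed.

Lemma hankel_mx_sym l : (hankel_mx l)^T = hankel_mx l.
Proof. by apply/matrixP => i j; rewrite [LHS]mxE !hankel_mxE !power_col_hankel addnC. Qed.

(** Multiplication by z is self-adjoint for l (a b). This is what makes zeta_n preserve each lattice
    of the family. *)
Lemma hankel_mx_comm l : hankel_mx l *m B^T = B *m hankel_mx l.
Proof.
have E i j : (B *m hankel_mx l) i j = (B ^+ j.+1 *m l) i 0.
  rewrite exprS -mulmxA [LHS]mxE [RHS]mxE; apply: eq_bigr => k _.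
  by rewrite hankel_mxE.
apply/trmx_inj; rewrite trmx_mul trmxK hankel_mx_sym.
by apply/matrixP => i j; rewrite [RHS]mxE !E !power_col_hankel addnC addSnnS addnC.
Qed.

Lemma hankel_mx_comm_exp l k : hankel_mx l *m (B ^+ k)^T = B ^+ k *m hankel_mx l.
Proof.
elim: k => [|k IHk]; first by rewrite expr0 trmx1 mulmx1 mul1mx.
by rewrite [in LHS]exprS trmx_mul mulmxA IHk -mulmxA hankel_mx_comm mulmxA exprSr.
Qed.

(** Exchanges the roles of [v] and [l]: for fixed [v] the value is linear in [l], with matrix
    multiplication by [v]. *)
Lemma mul_hankel_mx v l : (v *m hankel_mx l)^T = mul_op v *m l.
Proof.
rewrite trmx_mul hankel_mx_sym; apply/colP => i; rewrite [LHS]mxE mulmx_suml summxE.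
by apply: eq_bigr => j _; rewrite -scalemxAl !mxE mulrC.
Qed.

(** Only finitely many [v] have entries bounded by [K]; they are coded by ordinals shifted by [K].
    The bound lets the prime be chosen before the vectors. *)
Lemma mul_op_det_bound (K : nat) : exists D : nat, forall v : 'rV[int]_g,
  (forall i, (absz (v 0%R i) <= K)%N) -> (absz (\det (mul_op v)) <= D)%N.
Proof.
pose f (w : {ffun 'I_g -> 'I_(K + K).+1}) : 'rV[int]_g :=
  \row_i ((w i : nat)%:Z - K%:Z).
exists (\max_w absz (\det (mul_op (f w)))) => v vK.
have -> : v = f [ffun i => inord (absz (v 0 i + K%:Z))].
  apply/rowP => i; rewrite mxE ffunE inordK; have := vK i; lia.
exact: (@leq_bigmax _ (fun w => absz (\det (mul_op (f w))))).
Qed.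

(** Multiplying by the adjugate shows that [q] divides det * (l i - l' i). It is too large to divide
    the determinant, and both residues lie in [0, q). *)
Lemma hankel_mx_inj_mod (q : nat) (v m m' : 'rV[int]_g) (l l' : 'I_g -> 'I_q) :
  prime q -> \det (mul_op v) != 0 -> (absz (\det (mul_op v)) < q)%N ->
  q%:Z *: m + v *m hankel_mx (\col_i (l i : nat)%:Z) =
  q%:Z *: m' + v *m hankel_mx (\col_i (l' i : nat)%:Z) -> l =1 l'.
Proof.
move=> q_pr D0 Dq /(congr1 trmx); rewrite !linearD /= !mul_hankel_mx.
set a := \col__ _; set b := \col__ _ => E.
have {}E : mul_op v *m (a - b) = q%:Z *: (m'^T - m^T).
  move: E; rewrite !linearZ /= mulmxBr scalerBr => E; apply/eqP.
  by rewrite subr_eq addrAC -E [X in X - _]addrC addrK.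
move=> i; have := congr1 (fun x => (\adj (mul_op v) *m x) i 0) E.
rewrite mulmxA mul_adj_mx mul_scalar_mx -scalemxAr.
rewrite [LHS]mxE [RHS]mxE [(a - b) _ _]mxE [a _ _]mxE [(- b) _ _]mxE [b _ _]mxE.
set t := (_ *m _) i 0; set d := \det _ in D0 Dq * => h.
have : (q %| absz d * absz ((l i : nat)%:Z - (l' i : nat)%:Z))%N.
  by rewrite -abszM h abszM /= dvdn_mulr.
rewrite Euclid_dvdM// => /orP[/dvdn_leq|/dvdn_leq] hq.
  by move: hq; rewrite absz_gt0 D0 => /(_ isT); rewrite leqNgt Dq.
apply: val_inj; apply/eqP; apply: contraT => ne.
have := ltn_ord (l i); have := ltn_ord (l' i); move: hq ne => /=.
by lia.
Qed.

End Hankel.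

(** * Volumes of unions of boxes *)

Local Open Scope classical_set_scope.
Local Open Scope ring_scope.

Section LebesgueTuple.
Variable R : realType.

Lemma lebesgue_tuple_ge0 n (A : set (n.-tuple R)) : (0 <= lebesgue_tuple A)%E.
Proof.
elim: n A => [|n IHn] A /=; first by rewrite diracE lee_fin.
by apply: integral_ge0.
Qed.

(* Unlike [ge0_le_integral], no measurability is assumed. *)
Lemma integral_monotone (f g : R -> \bar R) :
  (forall x, 0 <= f x)%E -> (forall x, f x <= g x)%E ->
  (\int[@lebesgue_measure R]_x f x <= \int[@lebesgue_measure R]_x g x)%E.
Proof.
move=> f0 fg; have g0 x : (0 <= g x)%E by exact: le_trans (fg x).
rewrite !ge0_integralTE//; apply: ereal_sup_le => _ [h hf <-].
by exists h => // x; apply: le_trans (fg x).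
Qed.

(** Induction by slicing along the first coordinate: boxes whose first sides share a point are
    separated by a later coordinate. Nothing is assumed measurable about [A]. *)
Lemma sum_boxes_le_lebesgue_tuple n (I : finType) (Q : {set I})
    (a : I -> nat -> R) (d : nat -> R) (A : set (n.-tuple R)) :
  (forall k, 0 < d k) ->
  {in Q &, forall i j, i != j ->
    exists2 k, (k < n)%N & a i k + d k <= a j k \/ a j k + d k <= a i k} ->
  {in Q, forall i t, (forall k : 'I_n, a i k <= tnth t k < a i k + d k) -> A t} ->
  ((#|Q|%:R * \prod_(k < n) d k)%:E <= lebesgue_tuple A)%E.
Proof.
move=> d_gt0.
elim: n Q a d A d_gt0 => [|n IHn] Q a d A d_gt0 disj sub /=.
  (* In dimension 0 no coordinate can separate, so there is at most one box. *)
  rewrite big_ord0 mulr1 diracE lee_fin.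
  have [->|[i iQ]] := set_0Vmem Q; first by rewrite cards0 ler0n.
  have -> : Q = [set i]%SET.
    apply/setP => j; rewrite inE; apply/idP/eqP => [jQ|->//].
    by apply/eqP; apply/negPn/negP => /(disj _ _ jQ iQ)[].
  rewrite cards1 mem_set//; by apply: (sub i iQ) => -[].
pose J i := [set` `[a i 0%N, a i 0%N + d 0%N[ ] : set R.
pose c := \prod_(k < n) d k.+1.
have c_ge0 : 0 <= c by apply: prodr_ge0 => k _; exact: ltW.
have mJ i : measurable (J i : set (measurableTypeR R)) by exact: measurable_itv.
have intJ i : (\int[@lebesgue_measure R]_x (c * \1_(J i) x)%:E = (c * d 0%N)%:E)%E.
  under eq_integral do rewrite EFinM.
  rewrite ge0_integralZl_EFin//; last first.
    by apply/measurable_EFinP; apply: measurable_indic.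
  have -> : (\int[@lebesgue_measure R]_x (\1_(J i) x)%:E =
      lebesgue_measure (J i `&` setT))%E.
    by rewrite -integral_indic.
  rewrite setIT lebesgue_measure_itv/= lte_fin ltrDl d_gt0.
  by rewrite -EFinB addrAC subrr add0r EFinM.
have -> : (#|Q|%:R * \prod_(k < n.+1) d k)%:E =
    (\int[@lebesgue_measure R]_x \sum_(i <- enum Q) (c * \1_(J i) x)%:E)%E.
  rewrite ge0_integral_sum//; last 2 first.
  - move=> i; apply/measurable_EFinP; apply: measurable_funM => //.
  - by move=> i x _; rewrite lee_fin mulr_ge0.
  rewrite [RHS](eq_bigr (fun=> (c * d 0%N)%:E)); last by move=> i _; exact: intJ.
  rewrite big_enum/= sumEFin sumr_const big_ord_recl/= -[in RHS]mulr_natl.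
  by congr (_ * _)%:E; rewrite mulrC.
apply: integral_monotone => x.
  by apply: sume_ge0 => i _; rewrite lee_fin mulr_ge0.
pose Qx := [set i in Q | x \in J i]%SET.
have -> : (\sum_(i <- enum Q) (c * \1_(J i) x)%:E = (#|Qx|%:R * c)%:E)%E.
  rewrite sumEFin; congr EFin; rewrite big_enum/= mulr_natl -sumr_const.
  rewrite [RHS](eq_bigl (fun i => (i \in Q) && (x \in J i))); last first.
    by move=> i; rewrite inE.
  rewrite [RHS]big_mkcondr; apply: eq_bigr => i iQ; rewrite indicE.
  by case: (x \in J i); rewrite ?mulr1 ?mulr0.
have := IHn Qx (fun i k => a i k.+1) (fun k => d k.+1)
  [set t : n.-tuple R | A [tuple of x :: t]].
apply => // [i j|i].
  rewrite !inE => /andP[iQ xi] /andP[jQ xj] /(disj _ _ iQ jQ)[[|k] kn h].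
    move: xi xj; rewrite /J !inE/= !in_itv/= => /andP[? ?] /andP[? ?].
    by case: h => h; exfalso; lra.
  by exists k.
rewrite !inE => /andP[iQ xi] t ht; apply: (sub i iQ) => k.
case: (unliftP ord0 k) => [j ->|->].
  by rewrite tnthS /= /bump /= add1n; exact: ht.
by move: xi; rewrite /J inE/= in_itv/= tnth0.
Qed.

End LebesgueTuple.

(** * Abelian varieties from symplectic matrices *)

Section Covolume.
Variables (R : realType) (V : vectType R) (ip : {dot V for (@idfun R)}).
Implicit Types (L : set V) (b : (\dim {:V}).-tuple V).

Definition gram b := \matrix_(i, j) ip (tnth b i) (tnth b j).

Lemma gram_lincomb b b' (P : 'M[R]_(\dim {:V})) :
  (forall i, tnth b' i = \sum_j P i j *: tnth b j) ->
  gram b' = P *m gram b *m P^T.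
Proof.
move=> b'E; apply/matrixP => i k; rewrite !mxE !b'E linear_sumlz /=.
under eq_bigr => j _ do rewrite linearZl_LR /= linear_sumr /= mulr_sumr.
rewrite exchange_big /=; apply: eq_bigr => j _; rewrite !mxE mulr_suml.
by apply: eq_bigr => l _; rewrite linearZr_LR /= !mxE mulrA mulrAC.
Qed.

Lemma tnth_lattice_basis b L i : lattice_basis b L -> L (tnth b i).
Proof.
move=> [_ ->]; exists (fun j => (j == i)%:Z) => //.
rewrite (bigD1 i)//= eqxx mulr1z big1 ?addr0// => j /negPf ->.
by rewrite mulr0z.
Qed.

Lemma lattice_basis_change b b' L : lattice_basis b L -> lattice_basis b' L ->
  exists P : 'M[int]_(\dim {:V}),
    forall i, tnth b' i = \sum_j (P i j)%:~R *: tnth b j.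
Proof.
move=> [_ LE] /(tnth_lattice_basis)=> Lb'.
have /choice[f fE] i : exists m : 'I_(\dim {:V}) -> int,
    tnth b' i = \sum_j (m j)%:~R *: tnth b j.
  have := Lb' i; rewrite LE => -[m _ <-]; exists m.
  by apply: eq_bigr => j _; rewrite scaler_int.
by exists (\matrix_(i, j) f i j) => i; rewrite fE; apply: eq_bigr => j _; rewrite mxE.
Qed.

(** Two bases of a lattice differ by an integer matrix of determinant 1 or -1, which leaves the Gram
    determinant unchanged. *)
Lemma covolumeE b L : lattice_basis b L -> covolume ip L = Num.sqrt (\det (gram b)).
Proof.
move=> hb; rewrite /covolume; set b' := xget _ _.
have hb' : lattice_basis b' L.
  by have := @xgetPex _ (vbasis {:V}) [set b | lattice_basis b L]; apply; exists b.
have [P PE] := lattice_basis_change hb hb'.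
have [P' P'E] := lattice_basis_change hb' hb.
rewrite -/(gram b') (@gram_lincomb b b' (map_mx intr P)); last first.
  by move=> i; rewrite PE; apply: eq_bigr => j _; rewrite mxE.
have PP' : P *m P' = 1%:M.
  have /freeP fb' : free b' by case: hb' => /basis_free.
  apply/matrixP => i k; apply: (@intr_inj R); apply/eqP.
  rewrite -subr_eq0 -rmorphB /= -[X in _%:~R == X](rmorph0 intr).
  pose c k := ((P *m P') i k - (1%:M : 'M[int]_(\dim {:V})) i k)%:~R : R.
  rewrite rmorph0; apply/eqP; apply: (fb' c) => {k}.
  under eq_bigr => k _ do rewrite /c rmorphB /= scalerBl -(tnth_nth 0).
  rewrite sumrB [X in _ - X](bigD1 i)//= mxE eqxx scale1r [X in tnth b' i + X]big1.
    rewrite addr0 PE; apply/eqP; rewrite subr_eq0; apply/eqP.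
    under [RHS]eq_bigr => j _ do rewrite P'E scaler_sumr.
    rewrite [RHS]exchange_big /=.
    apply: eq_bigr => j _; rewrite mxE rmorph_sum scaler_suml.
    by apply: eq_bigr => l _; rewrite scalerA rmorphM.
  by move=> j ji; rewrite mxE eq_sym (negPf ji) scale0r.
have /eqP : absz (\det P * \det P') = 1%N by rewrite -det_mulmx PP' det1.
rewrite abszM muln_eq1 => /andP[/eqP d1 _].
have dd : \det (map_mx intr P) * \det (map_mx intr P) = 1 :> R.
  rewrite det_map_mx -rmorphM /= -expr2 -(real_normK (num_real _)).
  by rewrite -abszE d1 expr1n.
by rewrite !det_mulmx det_tr mulrAC dd mul1r.
Qed.

End Covolume.

Definition mx_lattice (R : realType) (V : vectType R) N (phi : 'rV[R]_N -> V)
    (M : 'M[R]_N) : set V :=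
  [set phi (map_mx intr z *m M) | z in [set: 'rV[int]_N]].

(** The images of the rows of [M] form a basis with Gram matrix [M *m M^T]. [N] is kept apart from
    the dimension so that the lemma applies to rows of length [g + g]. *)
Lemma mx_lattice_basis (R : realType) (V : vectType R) N
    (phi : {linear 'rV[R]_N -> V}) (psi : V -> 'rV[R]_N)
    (ip : {dot V for (@idfun R)}) (M : 'M[R]_N) :
  \dim {:V} = N -> cancel psi phi -> M \in unitmx ->
  (forall x y, ip (phi x) (phi y) = (x *m y^T) 0 0) ->
  is_lattice (mx_lattice phi M) /\ covolume ip (mx_lattice phi M) = `|\det M|.
Proof.
move=> dimV psiK uM ipE; subst N.
pose b := [tuple phi (row i M) | i < \dim {:V}].
have bE (c : 'I_(\dim {:V}) -> R) :
    \sum_i c i *: tnth b i = phi ((\row_i c i) *m M).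
  rewrite mulmx_sum_row linear_sum; apply: eq_bigr => i _.
  by rewrite tnth_mktuple mxE linearZ.
have hb : lattice_basis b [set phi (map_mx intr z *m M) | z in [set: 'rV[int]__]].
  split.
    rewrite basisEdim size_tuple leqnn andbT; apply/subvP => v _.
    rewrite -[v]psiK -[psi v](mulmxKV uM).
    have -> : psi v *m invmx M = \row_i (psi v *m invmx M) 0 i.
      by apply/rowP => i; rewrite mxE.
    rewrite -bE; apply: memv_suml => i _; apply: memvZ; apply: memv_span.
    exact: mem_tnth.
  have zE (z : 'I_(\dim {:V}) -> int) :
      phi (map_mx intr (\row_i z i) *m M) = \sum_i tnth b i *~ z i.
    under eq_bigr do rewrite -scaler_int.
    rewrite bE; congr (phi (_ *m _)); apply/rowP => i; by rewrite !mxE.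
  apply/seteqP; split => _ [z _ <-].
    by exists (fun i => z 0 i) => //; rewrite -zE; congr (phi (map_mx _ _ *m _));
      apply/rowP => i; rewrite mxE.
  by exists (\row_i z i) => //; rewrite zE.
split; first by exists b.
rewrite (covolumeE ip hb).
have -> : gram ip b = M *m M^T.
  apply/matrixP => i j; rewrite !mxE !tnth_mktuple ipE !mxE.
  by apply: eq_bigr => k _; rewrite !mxE.
by rewrite det_mulmx det_tr -expr2 sqrtr_sqr.
Qed.

Section Siegel.
Variables (R : realType) (g : nat).
Local Notation T := 'rV[R[i]]_g.
Local Notation TR := (realification T).

Definition of_re_im (x : 'rV[R]_(g + g)) : TR :=
  (\row_j Complex (lsubmx x 0 j) (rsubmx x 0 j) : T).

Definition re_im (u : TR) : 'rV[R]_(g + g) :=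
  row_mx (map_mx (@complex.Re R) (u : T)) (map_mx (@complex.Im R) (u : T)).

Lemma re_imK : cancel re_im of_re_im.
Proof.
move=> u; rewrite /of_re_im /re_im row_mxKl row_mxKr; apply/rowP => j; rewrite !mxE.
by case: ((u : T) 0 j).
Qed.

Fact of_re_im_is_linear : linear of_re_im.
Proof.
move=> a x y; apply/rowP => j.
transitivity (((a%:C)%C *: (of_re_im x : T) + (of_re_im y : T)) 0 j); last by [].
rewrite !mxE; by apply/eqP; rewrite eq_complex /= !mul0r subr0 addr0 !eqxx.
Qed.
HB.instance Definition _ :=
  GRing.isLinear.Build R 'rV[R]_(g + g) TR *:%R of_re_im of_re_im_is_linear.

Definition std_form : {dot T for @Num.conj R[i]} := @dotmx R[i] g.

Definition symplectic_mx (A : pzRingType) : 'M[A]_(g + g) :=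
  block_mx 0 (- 1%:M) 1%:M 0.

Lemma std_formE (x y : 'rV[R]_(g + g)) :
  std_form (of_re_im x) (of_re_im y) =
  Complex ((x *m y^T) 0 0) ((x *m symplectic_mx R *m y^T) 0 0).
Proof.
rewrite -[x]hsubmxK -[y]hsubmxK; move: (lsubmx x) (rsubmx x) (lsubmx y) (rsubmx y).
move=> a b c d {x y}; rewrite mul_row_block !mulmx0 addr0 add0r mulmx1 mulmxN mulmx1.
rewrite tr_row_mx !mul_row_col mulNmx /of_re_im !row_mxKl !row_mxKr /= dotmxE.
apply/eqP; rewrite eq_complex /=; apply/andP; split; apply/eqP.
  rewrite !mxE raddf_sum /= -big_split /=; apply: eq_bigr => j _.
  by rewrite !mxE /= mulrN opprK.
rewrite !mxE raddf_sum /= -sumrN -big_split /=; apply: eq_bigr => j _.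
by rewrite !mxE /= mulrN addrC.
Qed.

Lemma symplectic_mx_mul_tr (A : comPzRingType) :
  symplectic_mx A *m (symplectic_mx A)^T = 1%:M.
Proof.
rewrite tr_block_mx !linearN /= !trmx1 trmx0 mulmx_block !mulmx0 !mul0mx.
by rewrite mulNmx mulmxN opprK !mulmx1 !add0r !addr0 -scalar_mx_block.
Qed.

Lemma symplectic_unitmx (M : 'M[R]_(g + g)) :
  M *m symplectic_mx R *m M^T = symplectic_mx R -> M \in unitmx /\ `|\det M| = 1.
Proof.
move=> /(congr1 (fun Z => Z *m (symplectic_mx R)^T)); rewrite symplectic_mx_mul_tr.
move=> MM; split.
  by move: MM; rewrite -!mulmxA => /mulmx1_unit[].
have J1 : \det (symplectic_mx R) ^+ 2 = 1.
  by rewrite expr2 -[X in _ * X]det_tr -det_mulmx symplectic_mx_mul_tr det1.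
move: MM => /(congr1 determinant); rewrite !det_mulmx !det_tr det1.
move=> h.
have : \det M ^+ 2 = 1 by rewrite -[RHS]h -[LHS]mulr1 -J1; ring.
by move=> /eqP; rewrite sqrf_eq1 => /orP[] /eqP ->; rewrite ?normrN normr1.
Qed.

Lemma dim_tangent : dim T = g.
Proof. exact: etrans (dim_matrix _ _ _) (mul1n _). Qed.

Lemma dim_realification : \dim {:TR} = (g + g)%N.
Proof. by rewrite -[in RHS]dim_tangent; exact: dimvf. Qed.

(** The lattice spanned by the rows of a symplectic matrix is self-dual for the imaginary part of
    the standard Hermitian form, hence principally polarized, and has covolume 1. *)
Lemma symplectic_packing_le (M : 'M[R]_(g + g)) (r : R) : (0 < g)%N -> 0 < r ->
  M *m symplectic_mx R *m M^T = symplectic_mx R ->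
  (forall z : 'rV[int]_(g + g), z != 0 ->
     let x := map_mx intr z *m M in r ^+ 2 <= (x *m x^T) 0 0) ->
  (unit_ball_volume R (g + g) * ((r / 2) ^+ (g + g))%:E
     <= sup_injectivity_volume R g)%E.
Proof.
move=> g_gt0 r_gt0 sympM minM; have [uM detM] := symplectic_unitmx sympM.
have reE x y : @re_form R _ std_form (of_re_im x) (of_re_im y) = (x *m y^T) 0 0.
  by rewrite /re_form std_formE.
have [lat cov] := mx_lattice_basis (ip := @re_form R T std_form)
  dim_realification re_imK uM reE.
set L := mx_lattice _ _ in lat cov.
have sympE (a b : 'rV[R]_(g + g)) :
    a *m M *m symplectic_mx R *m (b *m M)^T = a *m symplectic_mx R *m b^T.
  by rewrite -[in RHS]sympM trmx_mul !mulmxA.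
have dimT : \dim {:T} = g by rewrite -[RHS]dim_tangent; exact: dimvf.
have intE u v : L u -> L v -> complex.Im (std_form u v) \is a Num.int.
  move=> [z _ <-] [z' _ <-]; rewrite std_formE /= sympE.
  have -> : map_mx intr z *m symplectic_mx R *m (map_mx intr z')^T =
      map_mx intr (z *m symplectic_mx int *m z'^T).
    by rewrite !map_mxM map_trmx map_block_mx map_mxN !map_mx1 !map_mx0.
  by rewrite mxE intr_int.
have prinE u : (forall v, L v -> complex.Im (std_form u v) \is a Num.int) -> L u.
  move=> hu; pose c := re_im u *m invmx M.
  have cE : re_im u = c *m M by rewrite mulmxKV.
  have c_int k : c 0 k \is a Num.int.
    (* Pairing with this lattice vector reads off the [k]-th coordinate of [u] in the basis [M]. *)
    pose z : 'rV[int]_(g + g) := delta_mx 0 k *m symplectic_mx int.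
    have /hu : L (of_re_im (map_mx intr z *m M)) by exists z.
    rewrite -[u]re_imK std_formE /= cE sympE.
    have -> : map_mx intr z = delta_mx 0 k *m symplectic_mx R.
      by rewrite map_mxM map_delta_mx map_block_mx map_mxN !map_mx1 !map_mx0.
    rewrite trmx_mul mulmxA -(mulmxA c) symplectic_mx_mul_tr mulmx1.
    by rewrite trmx_delta -colE mxE.
  exists (map_mx Num.floor c) => //; rewrite -[u]re_imK cE; congr (of_re_im (_ *m _)).
  by clearbody c; apply/rowP => k; rewrite !mxE floorK ?c_int.
pose A := @PPAV R g T dimT L lat std_form intE prinE.
apply: (@le_trans _ _ (injectivity_volume A)); last first.
  by apply: ereal_sup_ubound; exists A.
rewrite /injectivity_volume /packing_density /= cov detM divr1.
rewrite dim_realification; apply: lee_wpmul2l; first exact: lebesgue_tuple_ge0.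
have hr : r <= first_minimum (@re_form R T std_form) L.
  apply: lb_le_inf => [|_ [v [[z _ <-] v0] <-]].
    (* A nonzero lattice vector, so that the infimum is not taken over the empty set. *)
    pose z : 'rV[int]_(g + g) := const_mx 1.
    have z0 : z != 0.
      by apply/eqP => /rowP/(_ (lshift g (Ordinal g_gt0))); rewrite !mxE.
    pose v := of_re_im (map_mx intr z *m M).
    exists (Num.sqrt (@re_form R T std_form v v)), v => //; split; first by exists z.
    move=> /= v0; have := minM z z0; rewrite /= -reE -/v v0 linear0l leNgt.
    by rewrite exprn_gt0.
  rewrite [X in Num.sqrt X]reE -(ger0_norm (ltW r_gt0)) -sqrtr_sqr ler_sqrt.
    by apply: minM; apply: contra_not_neq v0 => ->; rewrite map_mx0 mul0mx linear0.
  by rewrite mxE sumr_ge0// => k _; rewrite [X in _ * X]mxE -expr2 sqr_ge0.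
rewrite lee_fin lerXn2r ?nnegrE//.
- by rewrite divr_ge0// ltW.
- by apply: divr_ge0 => //; exact: le_trans (ltW r_gt0) hr.
- by rewrite ler_pM2r ?invr_gt0//; exact: hr.
Qed.

End Siegel.

(** * Averaging over a family of lattices *)

Lemma sum_boxes_le_unit_ball (R : realType) N (I : finType) (a : I -> 'rV[R]_N)
    (d : 'rV[R]_N) :
  (forall k, 0 < d 0 k) ->
  (forall i j, i != j -> separates (a i - a j) d) ->
  (forall i (x : 'rV[R]_N),
     (forall k, a i 0 k <= x 0 k < a i 0 k + d 0 k) -> sqnorm x < 1) ->
  ((#|I|%:R * \prod_k d 0 k)%:E <= unit_ball_volume R N)%E.
Proof.
move=> d_gt0 sep sub.
(* The default 1 keeps the sides positive at every natural index. *)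
pose ext (x : 'rV[R]_N) (k : nat) := oapp (x 0) 1 (insub k : option 'I_N).
have extE x (k : 'I_N) : ext x k = x 0 k by rewrite /ext valK.
have := @sum_boxes_le_lebesgue_tuple R N I [set: I]%SET (fun i => ext (a i)) (ext d)
  [set x : N.-tuple R | \sum_(i < N) tnth x i ^+ 2 < 1].
rewrite cardsT; under [\prod_(k < N) _]eq_bigr do rewrite extE.
apply.
- by move=> k; rewrite /ext; case: insubP => //= i _ _.
- move=> i j _ _ /sep[k]; rewrite !mxE => hk; exists (k : nat).
    exact: ltn_ord.
  by rewrite /= !extE; case: hk => hk; [right|left]; lra.
move=> i _ t ht; have := sub i (\row_k tnth t k); rewrite sqnormE /=.
under eq_bigr do rewrite mxE.
by apply => k; rewrite mxE; have := ht k; rewrite /= !extE.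
Qed.

Section Averaging.
Variables (R : realType) (n g : nat) (B : 'M[int]_g) (e0 : 'rV[int]_g).
Hypothesis n_gt0 : (0 < n)%N.
Hypothesis e0B : forall i : 'I_g, e0 *m B ^+ i = delta_mx 0 i.
Hypothesis Bn : B ^+ n = 1.
Hypothesis det_mul_op : forall v : 'rV_g, v != 0 -> \det (mul_op B v) != 0.
Hypothesis det_free : forall k, (0 < k < n)%N -> \det (B ^+ k - 1) != 0.

Lemma mulmx_det_eq0 (v : 'rV[int]_g) (A : 'M[int]_g) : \det A != 0 ->
  v *m A = 0 -> v = 0.
Proof.
move=> dA /(congr1 (fun x => x *m \adj A)); rewrite -mulmxA mul_mx_adj mul0mx.
rewrite mul_mx_scalar => /rowP vA; apply/rowP => i.
by have := vA i; rewrite !mxE => /eqP; rewrite mulf_eq0 (negPf dA) => /eqP.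
Qed.

Lemma expmxD (a b : nat) : B ^+ (a + b) = B ^+ a *m B ^+ b.
Proof. exact: exprD. Qed.

Lemma power_orbit_inj (v : 'rV[int]_g) (k k' : 'I_n) : v != 0 ->
  v *m B ^+ k = v *m B ^+ k' -> k = k'.
Proof.
move=> v0; wlog : k k' / (k <= k')%N => [hw|kk' E].
  by case: (leqP k k') => [|/ltnW] h E; [|symmetry]; apply: hw => //.
apply: val_inj; apply/eqP; rewrite eqn_leq kk' leqNgt; apply/negP => lt_kk'.
have /negP := v0; apply; apply/eqP.
have := @det_free (k' - k)%N; rewrite subn_gt0 lt_kk'.
rewrite (leq_ltn_trans (leq_subr _ _))//.
move=> /(_ isT) /mulmx_det_eq0 h.
have : v *m B ^+ k = 0.
  apply: h; rewrite -mulmxA mulmxBr mulmx1 mulmxBr -expmxD.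
  by rewrite subnKC// E subrr.
move=> /(congr1 (fun x => x *m B ^+ (n - k))); rewrite mul0mx -mulmxA.
by rewrite -expmxD subnKC ?Bn ?mulmx1// ltnW.
Qed.

(** The gap between [r] and [s] leaves room for a grid cell around each short vector. *)
Lemma exists_symplectic_minimum (r s : R) : 0 < r < s ->
  (unit_ball_volume R (g + g) * (s ^+ (g + g))%:E < n%:R%:E)%E ->
  exists M : 'M[R]_(g + g), M *m symplectic_mx g R *m M^T = symplectic_mx g R /\
    forall z : 'rV[int]_(g + g), z != 0 -> r ^+ 2 <= sqnorm (map_mx intr z *m M).
Proof.
move=> /andP[r_gt0 rs] vol_lt; have s_gt0 := lt_trans r_gt0 rs.
have [P [Q [trP trQ dP dQ [PQ invP invQ]]]] := invariant_cholesky R n_gt0 Bn.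
have rs2 : r ^+ 2 < s ^+ 2 by rewrite ltr_pXn2r ?nnegrE ?(ltW r_gt0) ?(ltW s_gt0).
have r2_gt0 : 0 < r ^+ 2 by rewrite exprn_gt0.
(* [t] and [eps] share the gap evenly: a vector shorter than [r] plus an error of squared norm at
   most [eps] is shorter than [s]. *)
pose t := (s ^+ 2 - r ^+ 2) / (2 * r ^+ 2).
have t_gt0 : 0 < t by rewrite divr_gt0 ?subr_gt0 ?mulr_gt0.
have t1_gt0 : 0 < 1 + t^-1 by rewrite addr_gt0 ?invr_gt0.
pose eps := (s ^+ 2 - r ^+ 2) / 2 / (1 + t^-1).
have eps_gt0 : 0 < eps by rewrite !divr_gt0 ?subr_gt0.
have eps_t : (1 + t) * r ^+ 2 + (1 + t^-1) * eps = s ^+ 2.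
  rewrite /eps [(1 + t^-1) * _]mulrC divfK ?gt_eqF// /t.
  by field; rewrite gt_eqF.
pose diagP : 'rV[R]_g := \row_k P k k; pose diagQ : 'rV[R]_g := \row_k Q k k.
(* The second summand makes the boxes of the grid small, the third one makes
   the lattice vectors with [v = 0] long. *)
pose h := 1 + (sqnorm diagP + sqnorm diagQ) / eps + \sum_k r / Q k k.
have sumr_ge0' : 0 <= \sum_k r / Q k k.
  by apply: sumr_ge0 => k _; rewrite divr_ge0// ltW.
have S_ge0 : 0 <= sqnorm diagP + sqnorm diagQ by rewrite addr_ge0 ?sqnorm_ge0.
have Seps_ge0 : 0 <= (sqnorm diagP + sqnorm diagQ) / eps.
  by rewrite divr_ge0// ltW.
have h_ge1 : 1 <= h by rewrite /h; lra.
have h_gt0 : 0 < h by exact: lt_le_trans h_ge1.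
have h_eps : h ^- 2 * (sqnorm diagP + sqnorm diagQ) <= eps.
  rewrite mulrC ler_pdivrMr ?exprn_gt0// -ler_pdivrMl// mulrC.
  by rewrite expr2 (le_trans _ (ler_peMl (ltW h_gt0) h_ge1))// /h; lra.
have h_Q k : r <= h * Q k k.
  rewrite -ler_pdivrMr//; apply: (@le_trans _ _ (\sum_k r / Q k k)).
    by rewrite (bigD1 k)//= lerDl sumr_ge0// => j _; rewrite divr_ge0// ltW.
  by rewrite /h; lra.
(* Coordinates are recovered as v = (v P) Q. The bound depends on [r] and [h] only, so [q] can be
   chosen after it. *)
have [K KP] : exists K : nat, forall v : 'rV[int]_g,
    sqnorm (map_mx intr v *m P) < (r * h) ^+ 2 -> forall i, (absz (v 0%R i) <= K)%N.
  pose K0 := r * h * \sum_i \sum_j `|Q j i|.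
  exists (Num.bound K0) => v hv i.
  have K0_ge0 : 0 <= K0.
    by rewrite !mulr_ge0 ?(ltW r_gt0) ?(ltW h_gt0)// sumr_ge0// => ? _; rewrite sumr_ge0.
  have hK := archi_boundP K0_ge0.
  apply: ltnW; rewrite -(ltr_nat R); apply: le_lt_trans hK.
  have -> : (absz (v 0 i))%:R = `|(map_mx intr v *m P *m Q) 0 i|.
    by rewrite -mulmxA PQ mulmx1 mxE natr_absz intr_norm.
  rewrite mxE (le_trans (ler_norm_sum _ _ _))// /K0.
  rewrite [X in _ <= _ * X](bigD1 i)//= mulrDr.
  rewrite mulr_sumr ler_wpDr//.
    by rewrite !mulr_ge0 ?(ltW r_gt0) ?(ltW h_gt0)// sumr_ge0// => ? _; rewrite sumr_ge0.
  apply: ler_sum => j _; rewrite normrM ler_wpM2r//.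
  have := le_lt_trans (sqr_le_sqnorm _ j) hv.
  by rewrite -real_normK ?num_real// ltr_pXn2r ?nnegrE ?mulr_ge0 ?(ltW r_gt0)
    ?(ltW h_gt0)// => /ltW.
have [D DP] := mul_op_det_bound B K.
(* [q > D] gives injectivity modulo [q], and [q >= h ^+ 2] gives h / q <= h^-1, which bounds the
   cell. *)
have [q] := prime_above (maxn D (Num.bound (h ^+ 2))).
rewrite gtn_max => /andP[Dq hq] q_pr.
have hq2 : h ^+ 2 <= q%:R :> R.
  rewrite ltW// (lt_trans (archi_boundP (exprn_ge0 2 (ltW h_gt0))))//.
  by rewrite ltr_nat.
have q_gt0 : 0 < q%:R :> R by rewrite ltr0n prime_gt0.
pose X (l : 'I_g -> 'I_q) : 'M[int]_g := hankel_mx B (\col_i (l i : nat)%:Z).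
pose M l : 'M[R]_(g + g) := block_mx (h *: Q^T) 0
  ((h / q%:R) *: (map_mx intr (X l) *m Q^T)) (h^-1 *: P).
have sympM l : M l *m symplectic_mx g R *m (M l)^T = symplectic_mx g R.
  rewrite /M /symplectic_mx mulmx_block !mulmx0 !mul0mx !mulmx1 !mulmxN !mulmx1.
  rewrite !addr0 !add0r tr_block_mx mulmx_block trmx0 !mulmx0 !mul0mx.
  rewrite !addr0 !add0r !linearZ /= trmx_mul trmxK map_trmx (hankel_mx_sym e0B).
  rewrite -!scalemxAl -?scalemxAr !mulNmx -trmx_mul PQ trmx1 -[_ *m Q^T *m P^T]mulmxA.
  rewrite -trmx_mul PQ trmx1 mulmx1 mulmxA PQ mul1mx.
  rewrite !scalerN !scalerA mulVf ?mulfV ?gt_eqF// !scale1r [h^-1 * _]mulrC.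
  by rewrite subrr.
(* [pt (q m + X_l v) v] is the lattice vector [(m, v) * M l]; with [w] arbitrary,
   [pt w v] runs over a grid that contains all the lattices. *)
pose pt (w v : 'rV[int]_g) : 'rV[R]_(g + g) :=
  row_mx ((h / q%:R) *: (map_mx intr w *m Q^T)) (h^-1 *: (map_mx intr v *m P)).
have ptM l m v : map_mx intr (row_mx m v) *m M l = pt (q%:Z *: m + v *m X l) v.
  rewrite map_row_mx mul_row_block mulmx0 add0r /pt; congr row_mx; last first.
    by rewrite -scalemxAr.
  rewrite map_mxD map_mxZ map_mxM mulmxDl -scalemxAl scalerDr scalerA.
  by rewrite divfK ?gt_eqF// -!scalemxAr mulmxA.
have sqnorm_pt w v : sqnorm (pt w v) =
    (h / q%:R) ^+ 2 * sqnorm (map_mx intr w *m Q^T) +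
    h ^- 2 * sqnorm (map_mx intr v *m P).
  by rewrite sqnorm_row_mx !sqnormZ exprVn.
apply: contrapT => noM.
have bad (l : {ffun 'I_g -> 'I_q}) : exists mv : 'rV[int]_g * 'rV[int]_g,
    row_mx mv.1 mv.2 != 0 /\ sqnorm (pt (q%:Z *: mv.1 + mv.2 *m X l) mv.2) < r ^+ 2.
  apply: contrapT => ok; apply: noM; exists (M l); split=> // z z0.
  rewrite leNgt; apply/negP => lt_z; apply: ok; exists (lsubmx z, rsubmx z).
  by rewrite /= -ptM hsubmxK.
have [f fP] := choice bad.
pose w l := q%:Z *: (f l).1 + (f l).2 *m X l; pose v l := (f l).2.
(* With [v l = 0] the vector would be [h] times a nonzero point of the dual lattice, with a
   coordinate of size at least h * Q k k >= r. *)
have v_neq0 l : v l != 0.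
  apply/eqP => v0; have [fl0] := fP l; rewrite -/(v l) v0 mul0mx addr0.
  have sqnorm0 : sqnorm (0 : 'rV[R]_g) = 0 by rewrite /sqnorm mul0mx mxE.
  rewrite sqnorm_pt map_mx0 mul0mx sqnorm0 mulr0 addr0.
  have m0 : (f l).1 != 0.
    by apply: contraNneq fl0 => ->; rewrite -/(v l) v0 row_mx0.
  have [_ [k]] := trig_separates trQ dQ m0; rewrite [(\row__ _) 0 k]mxE => hk.
  rewrite map_mxZ -scalemxAl sqnormZ mulrA -exprMn divfK ?gt_eqF// ltNge.
  apply/negP/negPn; apply: le_trans (_ : (h * Q k k) ^+ 2 <= _).
    by rewrite lerXn2r ?nnegrE ?(ltW r_gt0) ?mulr_ge0 ?(ltW h_gt0) ?(ltW (dQ k)).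
  rewrite exprMn ler_pM2l ?exprn_gt0//; apply: le_trans (sqr_le_sqnorm _ k).
  by have := dQ k; case: hk => hk ?; nra.
(* The points [(l, k)] of the grid: the [k]-th power of [zeta_n] applied to the
   short vector of the lattice of [l]. *)
pose W (lk : {ffun 'I_g -> 'I_q} * 'I_n) := w lk.1 *m (B ^+ lk.2)^T.
pose U (lk : {ffun 'I_g -> 'I_q} * 'I_n) := v lk.1 *m B ^+ lk.2.
have small lk : sqnorm (pt (W lk) (U lk)) < r ^+ 2.
  have [_] := fP lk.1; rewrite -/(v _) -/(w _) /W /U !sqnorm_pt.
  have -> : sqnorm (map_mx intr (w lk.1 *m (B ^+ lk.2)^T) *m Q^T) =
      sqnorm (map_mx intr (w lk.1) *m Q^T).
    elim: (lk.2 : nat) => [|k IHk]; first by rewrite expr0 trmx1 mulmx1.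
    by rewrite exprS trmx_mul mulmxA map_mxM invQ IHk.
  have -> // : sqnorm (map_mx intr (v lk.1 *m B ^+ lk.2) *m P) =
      sqnorm (map_mx intr (v lk.1) *m P).
  elim: (lk.2 : nat) => [|k IHk]; first by rewrite expr0 mulmx1.
  by rewrite exprSr mulmxA map_mxM invP IHk.
have U_neq0 lk : U lk != 0.
  apply/eqP => /(congr1 (fun x => x *m B ^+ (n - lk.2))).
  rewrite mul0mx -mulmxA -expmxD subnKC; last exact: ltnW.
  by rewrite Bn mulmx1; exact/eqP.
(* The orbit stays in the lattice of the same functional. *)
have W_E lk : W lk = q%:Z *: ((f lk.1).1 *m (B ^+ lk.2)^T) + U lk *m X lk.1.
  rewrite /W /w mulmxDl -scalemxAl -mulmxA (hankel_mx_comm_exp e0B).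
  by rewrite /U mulmxA.
(* Injectivity modulo [q] recovers the functional, then freeness of the action recovers the
   exponent. *)
have WU_inj lk lk' : W lk = W lk' -> U lk = U lk' -> lk = lk'.
  move=> eW eU; have ll' : lk.1 = lk'.1.
    apply/ffunP; move: eW; rewrite !W_E -eU.
    apply: (hankel_mx_inj_mod e0B) => //; first exact: det_mul_op.
    apply: leq_ltn_trans (DP _ _) Dq; apply: KP.
    have := small lk; rewrite sqnorm_pt => /(le_lt_trans _) lt_r.
    rewrite exprMn -ltr_pdivrMr ?exprn_gt0// mulrC; apply: lt_r.
    by rewrite lerDr mulr_ge0 ?sqnorm_ge0 ?sqr_ge0.
  rewrite [lk]surjective_pairing [lk']surjective_pairing ll'; congr pair.
  by apply: (power_orbit_inj (v_neq0 lk'.1)); move: eU; rewrite /U ll'.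
pose del : 'rV[R]_(g + g) := row_mx ((h / q%:R) *: diagQ) (h^-1 *: diagP).
have hq_gt0 : 0 < h / q%:R by rewrite divr_gt0.
have hV_gt0 : 0 < h^-1 by rewrite invr_gt0.
have del_eps : sqnorm del <= eps.
  apply: le_trans h_eps; rewrite sqnorm_row_mx !sqnormZ exprVn addrC mulrDr.
  rewrite lerD2l ler_wpM2r ?sqnorm_ge0// -exprVn.
  rewrite lerXn2r ?nnegrE ?(ltW hq_gt0) ?(ltW hV_gt0)//.
  by rewrite ler_pdivrMr// mulrC ler_pdivlMr// -expr2.
have del_gt0 k : 0 < del 0 k.
  case: (split_ordP k) => j ->; rewrite ?row_mxEl ?row_mxEr [_ 0 j]mxE.
    by rewrite [diagQ _ _]mxE mulr_gt0.
  by rewrite [diagP _ _]mxE mulr_gt0.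
have scE m a (x : 'rV[R]_m) k : (a *: x) 0 k = a * x 0 k by rewrite mxE.
have sV_gt0 : 0 < s^-1 by rewrite invr_gt0.
(* The q^g functionals cancel the factor q^-g of the cell, the powers of [h] cancel, and the
   diagonals contribute det P * det Q = 1. *)
have prodE : (#|{: {ffun 'I_g -> 'I_q} * 'I_n}|%:R * \prod_k (s^-1 *: del) 0 k) =
    n%:R / s ^+ (g + g) :> R.
  rewrite card_prod card_ffun !card_ord natrM natrX big_split_ord /=.
  have -> : \prod_(k < g) (s^-1 *: del) 0 (lshift g k) =
      \prod_(k < g) (s^-1 * (h / q%:R) * Q k k).
    apply: eq_bigr => k _.
    by rewrite [LHS]mxE row_mxEl [(_ *: diagQ) _ _]mxE [diagQ _ _]mxE mulrA.
  have -> : \prod_(k < g) (s^-1 *: del) 0 (rshift g k) =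
      \prod_(k < g) (s^-1 * h^-1 * P k k).
    apply: eq_bigr => k _.
    by rewrite [LHS]mxE row_mxEr [(_ *: diagP) _ _]mxE [diagP _ _]mxE mulrA.
  rewrite !big_split /= !prodr_const !card_ord.
  have detPQ : (\prod_k P k k) * (\prod_k Q k k) = 1.
    by rewrite -(det_trig trP) -(det_trig trQ) -det_mulmx PQ det1.
  have pP : \prod_k P k k != 0 by apply/prodf_neq0 => k _; rewrite gt_eqF.
  have -> : \prod_k Q k k = (\prod_k P k k)^-1.
    by apply: (mulfI pP); rewrite detPQ mulfV.
  rewrite ?exprMn !exprVn exprD; field.
  by rewrite pP !expf_neq0 ?gt_eqF.
have : ((n%:R / s ^+ (g + g))%:E <= unit_ball_volume R (g + g))%E.
  rewrite -prodE.
  apply: (sum_boxes_le_unit_ball (a := fun lk => s^-1 *: pt (W lk) (U lk))).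
  - by move=> k; rewrite mxE mulr_gt0.
  - move=> lk lk' ne; rewrite -scalerBr.
    suff [k hk] : separates (pt (W lk) (U lk) - pt (W lk') (U lk')) del.
      exists k; rewrite !scE -mulrN !ler_pM2l//.
    have ptB : pt (W lk) (U lk) - pt (W lk') (U lk') =
        pt (W lk - W lk') (U lk - U lk').
      rewrite /pt !map_mxB !mulmxBl !scalerBr opp_row_mx add_row_mx //.
    (* Equal second halves force distinct first halves, which are then separated; otherwise the
       second halves are. *)
    rewrite ptB; have [eU|nU] := eqVneq (U lk) (U lk').
      have dW : W lk - W lk' != 0.
        by rewrite subr_eq0; apply: contraNneq ne => eW; apply/eqP; exact: WU_inj.
      have [_ [k hk]] := trig_separates trQ dQ dW.
      exists (lshift g k); rewrite !row_mxEl !scE -mulrN !ler_pM2l//.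
    have dU : U lk - U lk' != 0 by rewrite subr_eq0.
    have [[k hk] _] := trig_separates trP dP dU.
    by exists (rshift g k); rewrite !row_mxEr !scE -mulrN !ler_pM2l.
  - move=> lk x hx; pose e := s *: x - pt (W lk) (U lk).
    have e_del : sqnorm e <= sqnorm del.
      rewrite !sqnormE; apply: ler_sum => k _; have := hx k.
      have -> : e 0 k = s * x 0 k - pt (W lk) (U lk) 0 k.
        by rewrite [LHS]mxE scE [X in _ + X]mxE.
      rewrite !scE.
      rewrite -mulrDr ler_pdivrMl// ltr_pdivlMl// => /andP[lo hi].
      by rewrite lerXn2r ?nnegrE ?(ltW (del_gt0 k))//; lra.
    have := sqnormD_le (pt (W lk) (U lk)) e t_gt0.
    rewrite /e addrC subrK sqnormZ -/e => le_x.
    have : s ^+ 2 * sqnorm x < s ^+ 2 * 1.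
      rewrite mulr1 -[X in _ < X]eps_t; apply: le_lt_trans le_x _; apply: ltr_leD.
        by rewrite ltr_pM2l ?addr_gt0// small.
      by rewrite ler_pM2l// (le_trans e_del).
    by rewrite ltr_pM2l ?exprn_gt0.
apply/negP; rewrite -ltNge; move: vol_lt.
by rewrite EFinM -lte_pdivlMr// exprn_gt0.
Qed.

End Averaging.

(** A cube of side 1 / (N + 1) at the origin fits inside the ball. *)
Lemma unit_ball_volume_gt0 (R : realType) N : (0 < unit_ball_volume R N)%E.
Proof.
pose d : R := N.+1%:R^-1; have d_gt0 : 0 < d by rewrite invr_gt0.
have := @sum_boxes_le_unit_ball R N unit (fun=> 0) (const_mx d).
rewrite card_unit mul1r => box; apply: lt_le_trans (box _ _ _).
- rewrite lte_fin; apply: prodr_gt0 => k _; by rewrite mxE.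
- by move=> k; rewrite mxE.
- by case=> -[].
move=> _ x hx; rewrite sqnormE.
apply: (@le_lt_trans _ _ (\sum_(k < N) d)).
  apply: ler_sum => k _; have := hx k; rewrite !mxE add0r => /andP[x0 xd].
  have d1 : d <= 1 by rewrite invf_le1// ler1n.
  by nra.
by rewrite sumr_const card_ord -mulr_natr mulrC ltr_pdivrMr// mul1r ltr_nat.
Qed.

Lemma nth_root (R : realType) N (a : R) : (0 < N)%N -> 0 < a ->
  exists2 r : R, 0 < r & r ^+ N = a.
Proof.
move=> N0 a0; exists (a `^ (N%:R^-1)); first exact: powR_gt0.
by rewrite -powR_mulrn ?powR_ge0// -powRrM mulVf ?powRr1 ?ltW// pnatr_eq0 -lt0n.
Qed.

Lemma sup_injectivity_volume_totient (R : realType) n : (0 < n)%N ->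
  (n%:R%:E <= (4 ^+ totient n)%:E * sup_injectivity_volume R (totient n))%E.
Proof.
move=> n_gt0; have [g gn] : exists g, g.+1 = totient n.
  by exists (totient n).-1; rewrite prednK ?totient_gt0.
have [B [e0 [e0B Bn det_mul det_free]]] := cyclotomic_matrix n_gt0 gn.
rewrite -gn; set G := g.+1 in B e0 e0B Bn det_mul det_free *.
have GG : (0 < G + G)%N by [].
have := unit_ball_volume_gt0 R (G + G).
have ex := exists_symplectic_minimum (R := R) n_gt0 e0B Bn det_mul det_free.
have pack (M : 'M[R]_(G + G)) r := @symplectic_packing_le R G M r isT.
set V := sup_injectivity_volume R G in pack *.
case: (unit_ball_volume R (G + G)) ex pack => [v| |//] ex pack.
  rewrite lte_fin => v_gt0.
  have key (t : R) : 0 < t < n%:R -> (t%:E <= (4 ^+ G)%:E * V)%E.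
    move=> /andP[t_gt0 t_lt].
    have [r r_gt0 rE] := nth_root GG (divr_gt0 t_gt0 v_gt0).
    (* The balls of radii [r] and [s] get volumes [t] and the midpoint of [t] and [n], both below
       [n]. *)
    have t'_gt0 : 0 < (t + n%:R) / 2 by lra.
    have [s s_gt0 sE] := nth_root GG (divr_gt0 t'_gt0 v_gt0).
    have rs : r < s.
      rewrite -(@ltr_pXn2r _ _ GG) ?nnegrE ?ltW// rE sE ltr_pM2r ?invr_gt0//.
      by lra.
    have [||M [symp minM]] := ex r s; first by rewrite r_gt0.
      by rewrite sE -EFinM mulrC divfK ?gt_eqF// lte_fin; lra.
    have := pack M r r_gt0 symp minM.
    rewrite -EFinM expr_div_n rE exprD -exprMn => h.
    have -> : t%:E = ((4 ^+ G)%:E * (v * (t / v / (2 * 2) ^+ G))%:E)%E.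
      rewrite -EFinM; congr EFin; have -> : 2 * 2 = 4 :> R by ring.
      by field; rewrite expf_neq0 gt_eqF.
    by apply: lee_wpmul2l => //; rewrite lee_fin exprn_ge0.
  apply/lee_addgt0Pr => e e_gt0.
  have n0 : 0 < n%:R :> R by rewrite ltr0n.
  (* The maximum with n / 2 keeps [t] positive when [e] is large. *)
  pose t := Num.max (n%:R - e) (n%:R / 2).
  have t_e : n%:R <= t + e by rewrite -lerBlDr le_max lexx.
  apply: (@le_trans _ _ (t%:E + e%:E)%E); first by rewrite -EFinD lee_fin.
  rewrite leeD2r//; apply: key; rewrite lt_max gt_max ltrBlDr ltrDl e_gt0.
  by rewrite divr_gt0// orbT ltr_pdivrMr// ltr_pMr// ltr1n.
(* Were the ball of infinite volume, the standard lattice alone would make the supremum infinite. *)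
move=> _; have := pack 1%:M 1 ltr01.
rewrite mul1mx trmx1 mulmx1 gt0_mulye ?lte_fin ?exprn_gt0// => /(_ erefl).
rewrite leye_eq => V_oo.
suff /V_oo/eqP -> : forall z : 'rV[int]_(G + G), z != 0 ->
    let x := map_mx intr z *m 1%:M in 1 ^+ 2 <= (x *m x^T) 0 0 :> R.
  by rewrite gt0_muley ?leey// lte_fin exprn_gt0.
move=> z /rV0Pn[k zk]; rewrite /= mulmx1 -/(sqnorm _) expr1n.
apply: le_trans (sqr_le_sqnorm _ k); rewrite mxE -rmorphXn /= ler1z.
by rewrite -gtz0_ge1 exprn_even_gt0.
Qed.

(** * Arithmetic of the totient and conclusion *)

Lemma totient_lt n : (1 < n)%N -> (totient n < n)%N.
Proof.
move=> n_gt1; rewrite totient_count_coprime big_ltn ?(ltnW n_gt1)//.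
rewrite /coprime gcdn0 gtn_eqF// add0n.
apply: (@leq_ltn_trans (\sum_(1 <= i < n) 1)).
  by apply: leq_sum => i _; exact: leq_b1.
by rewrite sum_nat_const_nat muln1 subn1 prednK // ltnW.
Qed.

Lemma totient_3_pow2 k : totient (3 * 2 ^ k.+1) = (2 ^ k.+1)%N.
Proof.
by rewrite totient_coprime ?coprimeXr// totient_pfactor// mul1n expnS.
Qed.

(* Apart from powers of [2], the witness is [m = lcm(2, n)], the number of roots
   of unity of [Q(zeta_n)]. *)
Lemma totient_bound n : (3 <= n)%N ->
  (exists k, totient n = 2 ^ k.+1)%N \/
  exists2 m, (0 < m)%N & totient m = totient n /\ (2 * totient n + 2 <= m)%N.
Proof.
move=> n_ge3; have n_gt0 : (0 < n)%N by lia.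
have [m co2m nE] := pfactor_coprime (isT : prime 2) n_gt0.
move: (logn 2 n) nE => a nE; have m_odd : odd m by rewrite -coprime2n.
have [m1|m_neq1] := eqVneq m 1%N.
  left; move: nE; rewrite m1 mul1n => nE.
  case: a nE => [|[|a]] nE; [lia|lia|].
  by exists a; rewrite nE totient_pfactor// mul1n.
right; have m_gt1 : (1 < m)%N by case: (m) m_odd m_neq1 => [|[]].
have lt_m := totient_lt m_gt1.
case: a nE => [|a] nE.
  (* Here [n = m] is odd, and doubling it keeps the totient. *)
  exists (2 * m)%N; first by lia.
  rewrite nE expn0 muln1 totient_coprime// mul1n; split=> //; lia.
exists n => //; split => //.
(* Here n - 2 totient(n) = 2^(a+1) (m - totient(m)), which is at least 2. *)
rewrite nE totient_coprime ?coprimeXr// 1?coprime_sym// totient_pfactor//.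
have := expn_gt0 2 a; rewrite mul1n expnS /=; move: (2 ^ a)%N => p p0.
by nia.
Qed.

Theorem mainTheorem2 (R : realType) :
  (forall g : nat, (2 <= g)%N -> (exists k : nat, g = (2 ^ k)%N) ->
     ((3 * g)%:R%:E <= (4 ^+ g)%:E * sup_injectivity_volume R g)%E) /\
  (forall g : nat, (exists2 n : nat, (3 <= n)%N & g = totient n) ->
     ((2 * g + 2)%:R%:E <= (4 ^+ g)%:E * sup_injectivity_volume R g)%E).
Proof.
have alpha k : ((3 * 2 ^ k.+1)%:R%:E <=
    (4 ^+ (2 ^ k.+1))%:E * sup_injectivity_volume R (2 ^ k.+1))%E.
  rewrite -[in leRHS]totient_3_pow2; apply: sup_injectivity_volume_totient.
  by rewrite muln_gt0 expn_gt0.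
split=> [g g_ge2 [[|k] gE]|g [n n_ge3 ->]].
- by rewrite gE in g_ge2.
- by rewrite gE; exact: alpha.
case: (totient_bound n_ge3) => [[k ->]|[m m_gt0 [<- le_m]]].
  (* For g = 2^(k+1) >= 2 one has 3 g >= 2 g + 2. *)
  apply: le_trans (alpha k); rewrite lee_fin ler_nat.
  have := expn_gt0 2 k; rewrite expnS /=; lia.
apply: le_trans (sup_injectivity_volume_totient R m_gt0).
by rewrite lee_fin ler_nat.
Qed.
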